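(* Let $(\Omega^{(\bullet,\bullet)},\wedge,\partial,\overline\partial)$ be a factorizable complex structure over a $\ast$-algebra $B$ such that $\Omega^1$ is finitely generated and projective as a left $B$-module. Let $\mathscr{H}_1$ and $\mathscr{H}_2$ be Hermitian metrics on $\Omega^{(1,0)}$ and $\Omega^{(0,1)}=\Omega^{(1,0),\mathrm{op}}$ respectively. If $\nabla_{\mathrm{Ch}}$ and $\nabla_{\mathrm{Ch},\mathrm{op}}$ denote the Chern connections for the pairs $(\Omega^{(1,0)},\mathscr{H}_1)$ and $(\Omega^{(1,0),\mathrm{op}},\mathscr{H}_2)$ respectively (the latter with respect to the opposite complex structure), then the connection $$\nabla:=\nabla_{\mathrm{Ch}}+\nabla_{\mathrm{Ch},\mathrm{op}}:\Omega^1\to\Omega^1\otimes_B\Omega^1$$ is a bimodule connection on $\Omega^1=\Omega^{(1,0)}\oplus\Omega^{(0,1)}$.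
   Context: All algebras are unital over $\mathbb{C}$. A differential calculus over $B$ is a differential graded algebra $(\Omega^\bullet,\wedge,d)$ with $\Omega^0=B$, generated by $B$ and $dB$; a $\ast$-calculus has a degree-preserving conjugate-linear involution extending $\ast$ on $B$ with $(d\omega)^*=d(\omega^* )$, $(\omega\wedge\nu)^*=(-1)^{kl}\nu^*\wedge\omega^*$. A complex structure on a $\ast$-calculus is an $\mathbb{N}_0^2$-algebra grading $\Omega^\bullet=\bigoplus\Omega^{(p,q)}$ with $\Omega^k=\bigoplus_{p+q=k}\Omega^{(p,q)}$, $(\Omega^{(p,q)})^*=\Omega^{(q,p)}$, $d\Omega^{(p,q)}\subseteq\Omega^{(p+1,q)}\oplus\Omega^{(p,q+1)}$; $\pi^{(p,q)}$ are the projections, $\partial=\pi^{(p+1,q)}\circ d$ and $\overline\partial=\pi^{(p,q+1)}\circ d$ on $\Omega^{(p,q)}$. It is factorizable if the wedge maps $\Omega^{(0,q)}\otimes_B\Omega^{(p,0)}\to\Omega^{(p,q)}$ and $\Omega^{(p,0)}\otimes_B\Omega^{(0,q)}\to\Omega^{(p,q)}$ are invertible for all $p,q\in\mathbb{N}$; their inverses are denoted $\theta_l^{(p,q)}$ and $\theta_r^{(p,q)}$. The opposite complex structure is $\Omega^{(a,b),\mathrm{op}}=\Omega^{(b,a)}$, $\partial_{\mathrm{op}}=\overline\partial$, $\overline\partial_{\mathrm{op}}=\partial$. For a $B$-bimodule $M$, $\overline{M}=\{\overline m:m\in M\}$ is the conjugate vector space with $b\cdot\overline m=\overline{m b^*}$,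 $\overline m\cdot b=\overline{b^*m}$. ${}_B\mathrm{Hom}(M,B)$ (left $B$-linear maps) is a $B$-bimodule via $(bf)(m)=f(mb)$, $(fb)(m)=f(m)b$. A Hermitian metric on $\mathcal{E}$ is a $B$-bimodule isomorphism $\mathscr{H}:\overline{\mathcal{E}}\to{}_B\mathrm{Hom}(\mathcal{E},B)$ with $\langle f,\overline e\rangle^*=\langle e,\overline f\rangle$, where $\langle e,\overline f\rangle:=\mathscr{H}(\overline f)(e)$. A left connection on a $B$-bimodule $\mathcal{E}$ is a linear map $\nabla:\mathcal{E}\to\Omega^1\otimes_B\mathcal{E}$ with $\nabla(be)=b\nabla e+db\otimes_Be$; it is a bimodule connection if there is a $B$-bimodule map $\sigma:\mathcal{E}\otimes_B\Omega^1\to\Omega^1\otimes_B\mathcal{E}$ with $\nabla(eb)=\nabla(e)b+\sigma(e\otimes_Bdb)$. A left $\overline\partial$-connection is a linear map $\overline\partial_{\mathcal{E}}:\mathcal{E}\to\Omega^{(0,1)}\otimes_B\mathcal{E}$ with $\overline\partial_{\mathcal{E}}(be)=b\overline\partial_{\mathcal{E}}e+\overline\partial b\otimes_Be$; $(\mathcal{E},\overline\partial_{\mathcal{E}})$ is holomorphic if $(\overline\partial\otimes_B\mathrm{id}-\mathrm{id}\wedge\overline\partial_{\mathcal{E}})\overline\partial_{\mathcal{E}}=0$. $\nabla$ is compatible with $\mathscr{H}$ if $d\langle e,\overline f\rangle=(\mathrm{id}\otimes_B\langle\ ,\ \rangle)(\nabla e\otimes_B\overline f)+(\langle\ ,\ \rangle\otimes_B\mathrm{id})(e\otimes_B\widetilde\nabla\overline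 f)$, where $\widetilde\nabla(\overline f)=\sum_i\overline{x_i}\otimes_B\omega_i^*$ if $\nabla f=\sum_i\omega_i\otimes_Bx_i$. For a holomorphic bimodule $(\mathcal{E},\overline\partial_{\mathcal{E}})$, finitely generated projective as a left $B$-module, with Hermitian metric $\mathscr{H}$, the Chern connection is the unique left connection (it exists by Beggs--Majid) compatible with $\mathscr{H}$ with $(\pi^{(0,1)}\otimes_B\mathrm{id})\nabla=\overline\partial_{\mathcal{E}}$. $\Omega^{(1,0)}$ is regarded as a holomorphic bimodule via $\overline\partial_{\Omega^{(1,0)}}=\theta_l^{(1,1)}\circ\overline\partial$, and $\Omega^{(0,1)}=\Omega^{(1,0),\mathrm{op}}$ as a holomorphic bimodule for the opposite complex structure via $\theta_r^{(1,1)}\circ\partial:\Omega^{(0,1)}\to\Omega^{(1,0)}\otimes_B\Omega^{(0,1)}$. For $\omega\in\Omega^{(1,0)}$, $\eta\in\Omega^{(0,1)}$, $\nabla(\omega+\eta)=\nabla_{\mathrm{Ch}}(\omega)+\nabla_{\mathrm{Ch},\mathrm{op}}(\eta)$. *)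

(* Defs.v *)
From HB Require Import structures.
From mathcomp Require Import all_boot all_order all_algebra.
From mathcomp Require Import generic_quotient.
From mathcomp Require Import boolp classical_sets.
From mathcomp Require Import reals complex.

Set Implicit Arguments.
Unset Strict Implicit.
Unset Printing Implicit Defensive.

Import Order.TTheory GRing.Theory Num.Theory.
Local Open Scope ring_scope.
Local Open Scope quotient_scope.

(* The intended ground field is [R[i]] for [R : realType]; the definitions
   only use its conjugation. *)
HB.mixin Record isStarAlgebra (C : numClosedFieldType) B
    of GRing.Algebra C B := {
  star : B -> B ;
  starD : forall x y, star (x + y) = star x + star y ;
  starZ : forall (a : C) x, star (a *: x) = Num.conj a *: star x ;
  starM : forall x y, star (x * y) = star y * star x ;
  starK : involutive star
}.

#[short(type="starAlgType")]
HB.structure Definition StarAlgebra (C : numClosedFieldType) :=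
  {B of GRing.Algebra C B & isStarAlgebra C B}.

(* The left action is MathComp's [*:] for [lmodType B].  The vector space
   structure of a bimodule is the one induced by [a |-> a%:A : B];
   [ractC] says that it is the same on both sides. *)
HB.mixin Record isBimodule (C : numClosedFieldType) (B : algType C) M
    of GRing.Lmodule B M := {
  ract : M -> B -> M ;
  ractDl : forall b m m', ract (m + m') b = ract m b + ract m' b ;
  ractDr : forall m b b', ract m (b + b') = ract m b + ract m b' ;
  ractM : forall m b b', ract m (b * b') = ract (ract m b) b' ;
  ract1 : forall m, ract m 1 = m ;
  lractA : forall b m b', b *: ract m b' = ract (b *: m) b' ;
  ractC : forall m (a : C), ract m a%:A = a%:A *: m
}.

#[short(type="bimodType")]
HB.structure Definition Bimodule (C : numClosedFieldType) (B : algType C) :=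
  {M of GRing.Lmodule B M & isBimodule C B M}.
Arguments Bimodule.type {C} B.

Notation "m :* b" := (ract m b) : ring_scope.

Record bimodHom (C : numClosedFieldType) (B : algType C) (M N : bimodType B) :=
  BimodHom {
    bimod_fun :> {linear M -> N} ;
    bimod_funP : forall m b, bimod_fun (m :* b) = bimod_fun m :* b
  }.

Section BimodTheory.
Variables (C : numClosedFieldType) (B : algType C) (M : bimodType B).
Implicit Types (m : M) (b : B).

Lemma ract0l b : (0 : M) :* b = 0.
Proof. by apply: (addrI (0 :* b)); rewrite -ractDl !addr0. Qed.

Lemma ractNl b m : (- m) :* b = - (m :* b).
Proof. by apply: (addrI (m :* b)); rewrite -ractDl !subrr ract0l. Qed.

Definition bimod_id : bimodHom M M :=
  @BimodHom _ _ M M idfun (fun _ _ => erefl).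

End BimodTheory.

Definition finitely_generated (B : pzRingType) (M : lmodType B) :=
  exists (n : nat) (g : 'I_n -> M),
    forall m, exists c : 'I_n -> B, m = \sum_i c i *: g i.

Definition projective (B : pzRingType) (M : lmodType B) :=
  forall (X Y : lmodType B) (p : {linear X -> Y}) (f : {linear M -> Y}),
    (forall y, exists x, p x = y) ->
    exists g : {linear M -> X}, forall m, p (g m) = f m.

Definition Clinear (C : numClosedFieldType) (B : algType C)
    (M N : bimodType B) (f : M -> N) :=
  forall (a : C) x y, f (a%:A *: x + y) = a%:A *: f x + f y.

Section Tensor.
Variables (C : numClosedFieldType) (B : algType C) (M N : bimodType B).

Record balanced (Z : zmodType) (f : M -> N -> Z) : Prop := Balanced {
  balDl : forall m m' n, f (m + m') n = f m n + f m' n ;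
  balDr : forall m n n', f m (n + n') = f m n + f m n' ;
  balM : forall m b n, f (m :* b) n = f m (b *: n)
}.

(* A finite sequence of pairs stands for the sum of the corresponding
   elementary tensors; the free commutative monoid on M * N is divided by
   the congruence generated by biadditivity and B-balancedness.  Opposites
   come for free, as [- m] is available in M. *)
Inductive tens_rel : seq (M * N) -> seq (M * N) -> Prop :=
| tens_refl s : tens_rel s s
| tens_sym s t : tens_rel s t -> tens_rel t s
| tens_trans s t u : tens_rel s t -> tens_rel t u -> tens_rel s u
| tens_cat s s' t t' :
    tens_rel s s' -> tens_rel t t' -> tens_rel (s ++ t) (s' ++ t')
| tens_comm s t : tens_rel (s ++ t) (t ++ s)
| tens_0l n : tens_rel [:: (0, n)] [::]
| tens_Dl m m' n : tens_rel [:: (m + m', n)] [:: (m, n); (m', n)]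
| tens_Dr m n n' : tens_rel [:: (m, n + n')] [:: (m, n); (m, n')]
| tens_M m b n : tens_rel [:: (m :* b, n)] [:: (m, b *: n)].

Definition tens_eq (s t : seq (M * N)) : bool := `[< tens_rel s t >].

Lemma tens_eqP : equiv_class_of tens_eq.
Proof.
split=> [s|s t|t s u].
- by apply/asboolP; apply: tens_refl.
- by apply/asboolP/asboolP; apply: tens_sym.
- by move=> /asboolP st /asboolP tu; apply/asboolP; apply: tens_trans st tu.
Qed.

Canonical tens_equiv := EquivRelPack tens_eqP.

Definition tens : Type := {eq_quot tens_equiv}.
HB.instance Definition _ := Choice.on tens.
HB.instance Definition _ := EqQuotient.on tens.

Definition tens_pi (s : seq (M * N)) : tens := \pi_tens s.

Lemma tens_piP s t : tens_rel s t -> tens_pi s = tens_pi t.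
Proof. by move=> st; apply/eqmodP/asboolP. Qed.

Lemma tens_repr s : tens_rel (repr (tens_pi s)) s.
Proof.
apply/asboolP; apply/(eqmodP tens_equiv); exact: (reprK (\pi_tens s)).
Qed.

Lemma tens_piK (x : tens) : tens_pi (repr x) = x.
Proof. exact: reprK. Qed.

Definition tpure (m : M) (n : N) : tens := tens_pi [:: (m, n)].

Definition tens_add (x y : tens) := tens_pi (repr x ++ repr y).
Definition tens_opp (x : tens) :=
  tens_pi [seq (- p.1, p.2) | p <- repr x].
Definition tens_lact (b : B) (x : tens) :=
  tens_pi [seq (b *: p.1, p.2) | p <- repr x].
Definition tens_ract (x : tens) (b : B) :=
  tens_pi [seq (p.1, p.2 :* b) | p <- repr x].

Lemma tens_addE s t : tens_add (tens_pi s) (tens_pi t) = tens_pi (s ++ t).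
Proof. by apply: tens_piP; apply: tens_cat; apply: tens_repr. Qed.

(* [f] additive and right B-linear, [g] additive and left B-linear *)
Lemma tens_rel_map (f : M -> M) (g : N -> N) s t :
  {morph f : x y / x + y} -> (forall m b, f (m :* b) = f m :* b) ->
  {morph g : x y / x + y} -> (forall b n, g (b *: n) = b *: g n) ->
  tens_rel s t ->
  tens_rel [seq (f p.1, g p.2) | p <- s] [seq (f p.1, g p.2) | p <- t].
Proof.
move=> fD fM gD gM.
have f0 : f 0 = 0 by apply: (addrI (f 0)); rewrite -fD !addr0.
elim=> {s t}.
- by move=> s; apply: tens_refl.
- by move=> s t _; apply: tens_sym.
- by move=> s t u _ st _ tu; apply: tens_trans st tu.
- by move=> s s' t t' _ ss' _ tt'; rewrite !map_cat; apply: tens_cat.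
- by move=> s t; rewrite !map_cat; apply: tens_comm.
- by move=> n /=; rewrite f0; apply: tens_0l.
- by move=> m m' n /=; rewrite fD; apply: tens_Dl.
- by move=> m n n' /=; rewrite gD; apply: tens_Dr.
- by move=> m b n /=; rewrite fM gM; apply: tens_M.
Qed.

Lemma tens_oppE s :
  tens_opp (tens_pi s) = tens_pi [seq (- p.1, p.2) | p <- s].
Proof.
apply: tens_piP; apply: (@tens_rel_map -%R id) (tens_repr s) => //.
- exact: opprD.
- by move=> m b; rewrite ractNl.
Qed.

Lemma tens_lactE b s :
  tens_lact b (tens_pi s) = tens_pi [seq (b *: p.1, p.2) | p <- s].
Proof.
apply: tens_piP; apply: (@tens_rel_map ( *:%R b) id) (tens_repr s) => //.
- exact: scalerDr.
- by move=> m b'; rewrite lractA.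
Qed.

Lemma tens_ractE b s :
  tens_ract (tens_pi s) b = tens_pi [seq (p.1, p.2 :* b) | p <- s].
Proof.
apply: tens_piP.
apply: (@tens_rel_map id (@ract _ _ N ^~ b)) (tens_repr s) => //.
- exact: ractDl.
- by move=> b' m; rewrite lractA.
Qed.

Lemma tens_rel_map1 (f g : M * N -> M * N) s :
  (forall p, tens_rel [:: f p] [:: g p]) ->
  tens_rel (map f s) (map g s).
Proof.
move=> fg; elim: s => [|p s IHs] /=; first exact: tens_refl.
by rewrite -cat1s -[_ :: map g s]cat1s; apply: tens_cat.
Qed.

Lemma tens_rel_map2 (f g h : M * N -> M * N) s :
  (forall p, tens_rel [:: f p] [:: g p; h p]) ->
  tens_rel (map f s) (map g s ++ map h s).
Proof.
move=> fgh; elim: s => [|p s IHs] /=; first exact: tens_refl.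
apply: (tens_trans (t := [:: g p; h p] ++ (map g s ++ map h s))).
  by rewrite -cat1s; apply: tens_cat.
rewrite -[_ :: (_ ++ _ :: _)]/([:: g p] ++ (map g s ++ ([:: h p] ++ map h s))).
rewrite -[[:: g p; h p]]/([:: g p] ++ [:: h p]) -catA.
apply: tens_cat; first exact: tens_refl.
by rewrite !catA; apply: tens_cat; [apply: tens_comm | apply: tens_refl].
Qed.

Lemma tens_addA : associative tens_add.
Proof.
move=> x y z; rewrite -(tens_piK x) -(tens_piK y) -(tens_piK z).
by rewrite !tens_addE catA.
Qed.

Lemma tens_addC : commutative tens_add.
Proof.
move=> x y; rewrite -(tens_piK x) -(tens_piK y) !tens_addE.
by apply: tens_piP; apply: tens_comm.
Qed.

Lemma tens_add0 : left_id (tens_pi [::]) tens_add.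
Proof. by move=> x; rewrite -(tens_piK x) tens_addE. Qed.

Lemma tens_addN : left_inverse (tens_pi [::]) tens_opp tens_add.
Proof.
move=> x; rewrite -(tens_piK x) tens_oppE tens_addE; apply: tens_piP.
set s := repr x; rewrite -{2}[s]map_id.
apply: tens_trans (tens_sym (tens_rel_map2
  (f := fun p => (0, p.2)) (g := fun p => (- p.1, p.2)) (h := id) s _)) _.
  move=> [m n] /=; rewrite -[0](addNr m); exact: tens_Dl.
elim: s => [|p s IHs] /=; first exact: tens_refl.
rewrite -cat1s -[[::]]/([::] ++ [::]).
by apply: tens_cat => //; apply: tens_0l.
Qed.

HB.instance Definition _ := GRing.isZmodule.Build tens
  tens_addA tens_addC tens_add0 tens_addN.

Lemma tens_piD s t : tens_pi s + tens_pi t = tens_pi (s ++ t).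
Proof. exact: tens_addE. Qed.

Lemma tens_lactA a b x : tens_lact a (tens_lact b x) = tens_lact (a * b) x.
Proof.
rewrite -(tens_piK x) !tens_lactE -map_comp; congr tens_pi.
by apply: eq_map => p /=; rewrite scalerA.
Qed.

Lemma tens_lact1 : left_id 1 tens_lact.
Proof.
move=> x; rewrite -{2}(tens_piK x) -(tens_piK x) tens_lactE tens_piK.
congr tens_pi; rewrite -[RHS]map_id.
by apply: eq_map => -[m n] /=; rewrite scale1r.
Qed.

Lemma tens_lactDr : right_distributive tens_lact +%R.
Proof.
move=> b x y; rewrite -(tens_piK x) -(tens_piK y).
by rewrite tens_piD !tens_lactE tens_piD map_cat.
Qed.

Lemma tens_lactDl x : {morph tens_lact^~ x : a b / a + b}.
Proof.
move=> a b; rewrite -(tens_piK x) !tens_lactE tens_piD; apply: tens_piP.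
apply: tens_rel_map2 => p; rewrite scalerDl; exact: tens_Dl.
Qed.

HB.instance Definition _ := GRing.Zmodule_isLmodule.Build B tens
  tens_lactA tens_lact1 tens_lactDr tens_lactDl.

Lemma tens_ractDl b x y : tens_ract (x + y) b = tens_ract x b + tens_ract y b.
Proof.
rewrite -(tens_piK x) -(tens_piK y).
by rewrite tens_piD !tens_ractE tens_piD map_cat.
Qed.

Lemma tens_ractDr x a b : tens_ract x (a + b) = tens_ract x a + tens_ract x b.
Proof.
rewrite -(tens_piK x) !tens_ractE tens_piD; apply: tens_piP.
apply: tens_rel_map2 => p; rewrite ractDr; exact: tens_Dr.
Qed.

Lemma tens_ractM x a b : tens_ract x (a * b) = tens_ract (tens_ract x a) b.
Proof.
rewrite -(tens_piK x) !tens_ractE -map_comp; congr tens_pi.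
by apply: eq_map => p /=; rewrite ractM.
Qed.

Lemma tens_ract1 x : tens_ract x 1 = x.
Proof.
rewrite -{2}(tens_piK x) -(tens_piK x) tens_ractE tens_piK.
congr tens_pi; rewrite -[RHS]map_id.
by apply: eq_map => -[m n] /=; rewrite ract1.
Qed.

Lemma tens_lractA b x b' : b *: tens_ract x b' = tens_ract (b *: x) b'.
Proof.
rewrite -[b *: _]/(tens_lact _ _) -[b *: x]/(tens_lact _ _) -(tens_piK x).
by rewrite tens_lactE !tens_ractE tens_lactE -!map_comp.
Qed.

Lemma tens_ractC x (a : C) : tens_ract x a%:A = a%:A *: x.
Proof.
rewrite -[_ *: x]/(tens_lact _ _) -(tens_piK x) tens_lactE tens_ractE.
apply: tens_piP; apply: tens_rel_map1 => p.
rewrite ractC -[_ *: p.1]ractC; apply: tens_sym; exact: tens_M.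
Qed.

HB.instance Definition _ := isBimodule.Build C B tens
  tens_ractDl tens_ractDr tens_ractM tens_ract1 tens_lractA tens_ractC.

Lemma tpureDl m m' n : tpure (m + m') n = tpure m n + tpure m' n.
Proof. by rewrite tens_piD; apply: tens_piP; apply: tens_Dl. Qed.

Lemma tpureDr m n n' : tpure m (n + n') = tpure m n + tpure m n'.
Proof. by rewrite tens_piD; apply: tens_piP; apply: tens_Dr. Qed.

Lemma tpureM m b n : tpure (m :* b) n = tpure m (b *: n).
Proof. by apply: tens_piP; apply: tens_M. Qed.

Lemma tpureZl b m n : b *: tpure m n = tpure (b *: m) n.
Proof. exact: tens_lactE. Qed.

Lemma tpureZr m n b : tpure m n :* b = tpure m (n :* b).
Proof. exact: tens_ractE. Qed.

Lemma tens_sum x : x = \sum_(p <- repr x) tpure p.1 p.2.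
Proof.
rewrite -{1}(tens_piK x); elim: (repr x) => [|[m n] s IHs].
  by rewrite big_nil.
by rewrite big_cons -IHs tens_piD.
Qed.

(* The universal property: the additive map out of the tensor product
   attached to a balanced map. *)
Definition tlift (Z : zmodType) (f : M -> N -> Z) (fB : balanced f)
    (x : tens) : Z :=
  \sum_(p <- repr x) f p.1 p.2.

Lemma tens_rel_sum (Z : zmodType) (f : M -> N -> Z) s t : balanced f ->
  tens_rel s t -> \sum_(p <- s) f p.1 p.2 = \sum_(p <- t) f p.1 p.2.
Proof.
case=> fDl fDr fM; elim=> {s t} //.
- by move=> s t u _ -> _ ->.
- by move=> s s' t t' _ ss' _ tt'; rewrite !big_cat ss' tt'.
- by move=> s t; rewrite !big_cat /= addrC.
- move=> n; rewrite big_seq1 big_nil /=.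
  by apply: (addrI (f 0 n)); rewrite -fDl !addr0.
- by move=> m m' n; rewrite !big_cons !big_nil !addr0 /= fDl.
- by move=> m n n'; rewrite !big_cons !big_nil !addr0 /= fDr.
- by move=> m b n; rewrite !big_seq1 /= fM.
Qed.

Lemma tlift_pi (Z : zmodType) (f : M -> N -> Z) (fB : balanced f) s :
  tlift fB (tens_pi s) = \sum_(p <- s) f p.1 p.2.
Proof. exact: tens_rel_sum (tens_repr s). Qed.

Lemma tliftE (Z : zmodType) (f : M -> N -> Z) (fB : balanced f) m n :
  tlift fB (tpure m n) = f m n.
Proof. by rewrite tlift_pi big_seq1. Qed.

Lemma tliftD (Z : zmodType) (f : M -> N -> Z) (fB : balanced f) x y :
  tlift fB (x + y) = tlift fB x + tlift fB y.
Proof.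
rewrite -(tens_piK x) -(tens_piK y) tens_piD !tlift_pi.
by rewrite big_cat.
Qed.

End Tensor.

Lemma tmap_balanced (C : numClosedFieldType) (B : algType C)
  (M M' N N' : bimodType B) (f : bimodHom M M') (g : bimodHom N N') :
  balanced (fun m n => tpure (f m) (g n)).
Proof.
split=> [m m' n|m n n'|m b n].
- by rewrite linearD tpureDl.
- by rewrite linearD tpureDr.
- by rewrite bimod_funP tpureM linearZ.
Qed.

Definition tmap (C : numClosedFieldType) (B : algType C)
    (M M' N N' : bimodType B) (f : bimodHom M M') (g : bimodHom N N') :
  tens M N -> tens M' N' := tlift (tmap_balanced f g).

Definition conjm (C : numClosedFieldType) (B : starAlgType C)
  (M : bimodType B) : Type := M.

Definition bar (C : numClosedFieldType) (B : starAlgType C)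
  (M : bimodType B) (m : M) : conjm M := m.

Section Conj.
Variables (C : numClosedFieldType) (B : starAlgType C) (M : bimodType B).

HB.instance Definition _ := GRing.Zmodule.on (conjm M).

Lemma star1 : star (1 : B) = 1.
Proof. by rewrite -[RHS]starK -[star 1]mul1r starM starK mul1r. Qed.

Lemma starA (a : C) : star (a%:A : B) = (Num.conj a)%:A.
Proof. by rewrite starZ star1. Qed.

Definition conj_lact (b : B) (m : conjm M) : conjm M := bar ((m : M) :* star b).
Definition conj_ract (m : conjm M) (b : B) : conjm M := bar (star b *: (m : M)).

Lemma conj_lactA a b x : conj_lact a (conj_lact b x) = conj_lact (a * b) x.
Proof. by rewrite /conj_lact /bar starM ractM. Qed.

Lemma conj_lact1 : left_id 1 conj_lact.
Proof. by move=> x; rewrite /conj_lact /bar star1 ract1. Qed.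

Lemma conj_lactDr : right_distributive conj_lact +%R.
Proof. by move=> b x y; rewrite /conj_lact /bar ractDl. Qed.

Lemma conj_lactDl x : {morph conj_lact^~ x : a b / a + b}.
Proof. by move=> a b; rewrite /conj_lact /bar starD ractDr. Qed.

HB.instance Definition _ := GRing.Zmodule_isLmodule.Build B (conjm M)
  conj_lactA conj_lact1 conj_lactDr conj_lactDl.

Lemma conj_ractDl b x y : conj_ract (x + y) b = conj_ract x b + conj_ract y b.
Proof. by rewrite /conj_ract /bar scalerDr. Qed.

Lemma conj_ractDr x a b : conj_ract x (a + b) = conj_ract x a + conj_ract x b.
Proof. by rewrite /conj_ract /bar starD scalerDl. Qed.

Lemma conj_ractM x a b : conj_ract x (a * b) = conj_ract (conj_ract x a) b.
Proof. by rewrite /conj_ract /bar starM scalerA. Qed.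

Lemma conj_ract1 x : conj_ract x 1 = x.
Proof. by rewrite /conj_ract /bar star1 scale1r. Qed.

Lemma conj_lractA b x b' : b *: conj_ract x b' = conj_ract (b *: x) b'.
Proof.
rewrite -[b *: _]/(conj_lact _ _) -[b *: x]/(conj_lact _ _).
by rewrite /conj_ract /conj_lact /bar lractA.
Qed.

Lemma conj_ractC x (a : C) : conj_ract x a%:A = a%:A *: x.
Proof.
rewrite -[_ *: x]/(conj_lact _ _).
by rewrite /conj_ract /conj_lact /bar starA ractC.
Qed.

HB.instance Definition _ := isBimodule.Build C B (conjm M)
  conj_ractDl conj_ractDr conj_ractM conj_ract1 conj_lractA conj_ractC.

End Conj.

Definition ldual (C : numClosedFieldType) (B : algType C) (M : bimodType B) :
  Type := {linear M -> B^o}.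

Section LeftDual.
Variables (C : numClosedFieldType) (B : algType C) (M : bimodType B).

HB.instance Definition _ := gen_eqMixin (ldual M).
HB.instance Definition _ := gen_choiceMixin (ldual M).

Definition ldual_fun (f : ldual M) : M -> B := (f : {linear M -> B^o}).

Lemma ldualP (f g : ldual M) : ldual_fun f =1 ldual_fun g -> f = g.
Proof.
rewrite /ldual_fun.
case: f g => [f [[?] [?]]] [g [[?] [?]]] /= /funext fg; subst g.
by congr (GRing.Linear.Pack (GRing.Linear.Class _ _)); congr (_ _);
   apply: Prop_irrelevance.
Qed.

Definition ldual_mk (f : M -> B^o) (fD : {morph f : x y / x + y})
    (fZ : forall b m, f (b *: m) = b * f m) : ldual M :=
  let lin : linear f := fun a u v =>
    etrans (fD _ _) (congr1 (+%R^~ (f v)) (fZ a u)) in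
  HB.pack_for {linear M -> B^o} f (GRing.isLinear.Build B M B^o _ f lin).

Lemma ldual_funD (f : ldual M) : {morph ldual_fun f : x y / x + y}.
Proof. exact: (linearD (f : {linear M -> B^o})). Qed.

Lemma ldual_funZ (f : ldual M) b m : ldual_fun f (b *: m) = b * ldual_fun f m.
Proof. exact: (linearZ_LR (f : {linear M -> B^o})). Qed.

Definition ldual_zero : ldual M.
Proof.
apply: (@ldual_mk (fun=> 0)) => [x y|b m]; first by rewrite addr0.
by rewrite mulr0.
Defined.

Definition ldual_opp (f : ldual M) : ldual M.
Proof.
apply: (@ldual_mk (fun m => - ldual_fun f m)) => [x y|b m].
  by rewrite ldual_funD opprD.
by rewrite ldual_funZ mulrN.
Defined.

Definition ldual_add (f g : ldual M) : ldual M.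
Proof.
apply: (@ldual_mk (fun m => ldual_fun f m + ldual_fun g m)) => [x y|b m].
  by rewrite !ldual_funD addrACA.
by rewrite !ldual_funZ mulrDr.
Defined.

Definition ldual_lact (b : B) (f : ldual M) : ldual M.
Proof.
apply: (@ldual_mk (fun m => ldual_fun f (m :* b))) => [x y|b' m].
  by rewrite ractDl ldual_funD.
by rewrite -lractA ldual_funZ.
Defined.

Definition ldual_ract (f : ldual M) (b : B) : ldual M.
Proof.
apply: (@ldual_mk (fun m => ldual_fun f m * b)) => [x y|b' m].
  by rewrite ldual_funD mulrDl.
by rewrite ldual_funZ mulrA.
Defined.

Lemma ldual_addA : associative ldual_add.
Proof. by move=> f g h; apply: ldualP => m; apply: addrA. Qed.

Lemma ldual_addC : commutative ldual_add.
Proof. by move=> f g; apply: ldualP => m; apply: addrC. Qed.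

Lemma ldual_add0 : left_id ldual_zero ldual_add.
Proof. by move=> f; apply: ldualP => m; apply: add0r. Qed.

Lemma ldual_addN : left_inverse ldual_zero ldual_opp ldual_add.
Proof. by move=> f; apply: ldualP => m; apply: addNr. Qed.

HB.instance Definition _ := GRing.isZmodule.Build (ldual M)
  ldual_addA ldual_addC ldual_add0 ldual_addN.

Lemma ldual_lactA a b f : ldual_lact a (ldual_lact b f) = ldual_lact (a * b) f.
Proof. by apply: ldualP => m; rewrite /ldual_fun /= -ractM. Qed.

Lemma ldual_lact1 : left_id 1 ldual_lact.
Proof. by move=> f; apply: ldualP => m; rewrite /ldual_fun /= ract1. Qed.

Lemma ldual_lactDr : right_distributive ldual_lact +%R.
Proof. by move=> b f g; apply: ldualP. Qed.

Lemma ldual_lactDl f : {morph ldual_lact^~ f : a b / a + b}.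
Proof.
move=> a b; apply: ldualP => m.
rewrite [LHS]/(ldual_fun f (m :* (a + b))) ractDr; exact: ldual_funD.
Qed.

HB.instance Definition _ := GRing.Zmodule_isLmodule.Build B (ldual M)
  ldual_lactA ldual_lact1 ldual_lactDr ldual_lactDl.

Lemma ldual_ractDl b f g :
  ldual_ract (f + g) b = ldual_ract f b + ldual_ract g b.
Proof. by apply: ldualP => m; apply: mulrDl. Qed.

Lemma ldual_ractDr f a b :
  ldual_ract f (a + b) = ldual_ract f a + ldual_ract f b.
Proof. by apply: ldualP => m; apply: mulrDr. Qed.

Lemma ldual_ractM f a b : ldual_ract f (a * b) = ldual_ract (ldual_ract f a) b.
Proof. by apply: ldualP => m; apply: mulrA. Qed.

Lemma ldual_ract1 f : ldual_ract f 1 = f.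
Proof. by apply: ldualP => m; apply: mulr1. Qed.

Lemma ldual_lractA b f b' : b *: ldual_ract f b' = ldual_ract (b *: f) b'.
Proof. by apply: ldualP. Qed.

Lemma ldual_ractC f (a : C) : ldual_ract f a%:A = a%:A *: f.
Proof.
apply: ldualP => m.
have -> : ldual_fun (a%:A *: f) m = ldual_fun f (m :* a%:A) by [].
by rewrite ractC ldual_funZ mulr_algl; exact: mulr_algr.
Qed.

HB.instance Definition _ := isBimodule.Build C B (ldual M)
  ldual_ractDl ldual_ractDr ldual_ractM ldual_ract1 ldual_lractA ldual_ractC.

Lemma ldual_lactE b (f : ldual M) m :
  ldual_fun (b *: f) m = ldual_fun f (m :* b).
Proof. by []. Qed.

Lemma ldual_ractE b (f : ldual M) m :
  ldual_fun (f :* b) m = ldual_fun f m * b.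
Proof. by []. Qed.

End LeftDual.

Record hermitian_metric (C : numClosedFieldType) (B : starAlgType C)
    (E : bimodType B) := HermitianMetric {
  hm : bimodHom (conjm E) (ldual E) ;
  hm_bij : bijective hm ;
  hm_sym : forall e f : E,
    star (ldual_fun (hm (bar e)) f) = ldual_fun (hm (bar f)) e
}.

(* [pairing H e (bar f)] is <e, \bar f>. *)
Definition pairing (C : numClosedFieldType) (B : starAlgType C)
    (E : bimodType B) (H : hermitian_metric E) (e : E) (f : conjm E) : B :=
  ldual_fun (hm H f) e.

Section Pairing.
Variables (C : numClosedFieldType) (B : starAlgType C) (E : bimodType B).
Variable H : hermitian_metric E.

Lemma pairingDl e e' f : pairing H (e + e') f = pairing H e f + pairing H e' f.
Proof. exact: ldual_funD. Qed.

Lemma pairingDr e f f' : pairing H e (f + f') = pairing H e f + pairing H e f'.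
Proof. by rewrite /pairing linearD. Qed.

Lemma pairingZl b e f : pairing H (b *: e) f = b * pairing H e f.
Proof. exact: ldual_funZ. Qed.

Lemma pairingZr b e f : pairing H e (f :* b) = pairing H e f * b.
Proof. by rewrite /pairing bimod_funP. Qed.

Lemma pairingM b e f : pairing H (e :* b) f = pairing H e (b *: f).
Proof. by rewrite /pairing linearZ. Qed.

End Pairing.

(* Homogeneous components are represented as sub-B-bimodules of the total
   algebra [A], where B acts through [iotaB]. *)
Record subbimod (C : numClosedFieldType) (B : algType C) (A : algType C)
    (iotaB : {lrmorphism B -> A}) := Subbimod {
  subbimod_set :> A -> Prop ;
  subbimod0 : subbimod_set 0 ;
  subbimodD : forall x y,
    subbimod_set x -> subbimod_set y -> subbimod_set (x + y) ;
  subbimodZl : forall b x, subbimod_set x -> subbimod_set (iotaB b * x) ;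
  subbimodZr : forall b x, subbimod_set x -> subbimod_set (x * iotaB b)
}.

Record forms (C : numClosedFieldType) (B : algType C) (A : algType C)
    (iotaB : {lrmorphism B -> A}) (S : subbimod iotaB) := Form {
  form_val : A ;
  form_valP : `[< S form_val >]
}.

Section FormBimodule.
Variables (C : numClosedFieldType) (B : algType C) (A : algType C).
Variables (iotaB : {lrmorphism B -> A}) (S : subbimod iotaB).

HB.instance Definition _ := [isSub for @form_val _ _ _ _ S].
HB.instance Definition _ := [Choice of forms S by <:].

Definition mkform (x : A) (Sx : S x) : forms S := Form (asboolT Sx).

Lemma form_in (x : forms S) : S (form_val x).
Proof. exact: asboolW (form_valP x). Qed.

Lemma form_eq (x y : forms S) : form_val x = form_val y -> x = y.
Proof. exact: val_inj. Qed.

Lemma subbimodN x : S x -> S (- x).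
Proof.
move=> Sx; rewrite -mulN1r -(rmorph1 iotaB) -rmorphN.
exact: subbimodZl.
Qed.

Definition form_zero : forms S := mkform (subbimod0 S).
Definition form_opp (x : forms S) : forms S := mkform (subbimodN (form_in x)).
Definition form_add (x y : forms S) : forms S :=
  mkform (subbimodD (form_in x) (form_in y)).
Definition form_lact (b : B) (x : forms S) : forms S :=
  mkform (subbimodZl b (form_in x)).
Definition form_ract (x : forms S) (b : B) : forms S :=
  mkform (subbimodZr b (form_in x)).

Lemma form_addA : associative form_add.
Proof. by move=> x y z; apply: form_eq; apply: addrA. Qed.
Lemma form_addC : commutative form_add.
Proof. by move=> x y; apply: form_eq; apply: addrC. Qed.
Lemma form_add0 : left_id form_zero form_add.
Proof. by move=> x; apply: form_eq; apply: add0r. Qed.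
Lemma form_addN : left_inverse form_zero form_opp form_add.
Proof. by move=> x; apply: form_eq; apply: addNr. Qed.

HB.instance Definition _ := GRing.isZmodule.Build (forms S)
  form_addA form_addC form_add0 form_addN.

Lemma form_lactA a b x : form_lact a (form_lact b x) = form_lact (a * b) x.
Proof. by apply: form_eq; rewrite /= rmorphM mulrA. Qed.
Lemma form_lact1 : left_id 1 form_lact.
Proof. by move=> x; apply: form_eq; rewrite /= rmorph1 mul1r. Qed.
Lemma form_lactDr : right_distributive form_lact +%R.
Proof. by move=> b x y; apply: form_eq; apply: mulrDr. Qed.
Lemma form_lactDl x : {morph form_lact^~ x : a b / a + b}.
Proof. by move=> a b; apply: form_eq; rewrite /= rmorphD mulrDl. Qed.

HB.instance Definition _ := GRing.Zmodule_isLmodule.Build B (forms S)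
  form_lactA form_lact1 form_lactDr form_lactDl.

Lemma form_ractDl b x y : form_ract (x + y) b = form_ract x b + form_ract y b.
Proof. by apply: form_eq; apply: mulrDl. Qed.
Lemma form_ractDr x a b : form_ract x (a + b) = form_ract x a + form_ract x b.
Proof. by apply: form_eq; rewrite /= rmorphD mulrDr. Qed.
Lemma form_ractM x a b : form_ract x (a * b) = form_ract (form_ract x a) b.
Proof. by apply: form_eq; rewrite /= rmorphM mulrA. Qed.
Lemma form_ract1 x : form_ract x 1 = x.
Proof. by apply: form_eq; rewrite /= rmorph1 mulr1. Qed.
Lemma form_lractA b x b' : b *: form_ract x b' = form_ract (b *: x) b'.
Proof. by apply: form_eq; apply: mulrA. Qed.
Lemma form_ractC x (a : C) : form_ract x a%:A = a%:A *: x.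
Proof.
apply: form_eq; have -> : form_val (a%:A *: x) = iotaB a%:A * form_val x by [].
by rewrite /= rmorph_alg mulr_algl mulr_algr.
Qed.

HB.instance Definition _ := isBimodule.Build C B (forms S)
  form_ractDl form_ractDr form_ractM form_ract1 form_lractA form_ractC.

Lemma form_valD (x y : forms S) : form_val (x + y) = form_val x + form_val y.
Proof. by []. Qed.
Lemma form_valZl b (x : forms S) : form_val (b *: x) = iotaB b * form_val x.
Proof. by []. Qed.
Lemma form_valZr (x : forms S) b : form_val (x :* b) = form_val x * iotaB b.
Proof. by []. Qed.

End FormBimodule.

(* [A] is the direct sum of the [S i], with projections [pr i]. *)
Record direct_sum (C : numClosedFieldType) (A : algType C) (I : eqType)
    (S : I -> A -> Prop) (pr : I -> {linear A -> A}) : Prop := DirectSum {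
  pr_in : forall i x, S i (pr i x) ;
  pr_id : forall i x, S i x -> pr i x = x ;
  pr_ne : forall i j x, S i x -> j != i -> pr j x = 0 ;
  pr_sum : forall x, exists s : seq I, uniq s /\ x = \sum_(i <- s) pr i x
}.

(* [calc_alg] is the total algebra Omega^\bullet; B is identified with
   Omega^0 through [iotaB]. *)
Record diff_calculus (C : numClosedFieldType) (B : algType C) :=
  DiffCalculus {
    calc_alg :> algType C ;
    iotaB : {lrmorphism B -> calc_alg} ;
    Omk : nat -> subbimod iotaB ;
    dext : {linear calc_alg -> calc_alg} ;
    iotaB_inj : injective iotaB ;
    Omk_sum : exists pr, direct_sum (fun k => subbimod_set (Omk k)) pr ;
    OmkM : forall k l x y, Omk k x -> Omk l y -> Omk (k + l) (x * y) ;
    Omk0 : forall x, Omk 0 x <-> exists b, x = iotaB b ;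
    dext_deg : forall k x, Omk k x -> Omk k.+1 (dext x) ;
    dextK : forall x, dext (dext x) = 0 ;
    dextM : forall k x y, Omk k x ->
      dext (x * y) = dext x * y + (-1) ^+ k * (x * dext y) ;
    calc_gen : forall P : calc_alg -> Prop,
      (forall b, P (iotaB b)) ->
      (forall b, P (dext (iotaB b))) ->
      (forall x y, P x -> P y -> P (x + y)) ->
      (forall x y, P x -> P y -> P (x * y)) ->
      forall x, P x
  }.

Record star_calculus (C : numClosedFieldType) (B : starAlgType C) :=
  StarCalculus {
    star_calc :> diff_calculus B ;
    fstar : star_calc -> star_calc ;
    fstarD : forall x y, fstar (x + y) = fstar x + fstar y ;
    fstarZ : forall (a : C) x, fstar (a *: x) = Num.conj a *: fstar x ;
    fstarK : involutive fstar ;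
    fstar_deg : forall k x, Omk star_calc k x -> Omk star_calc k (fstar x) ;
    fstar_iotaB : forall b,
      fstar (iotaB star_calc b) = iotaB star_calc (star b) ;
    fstar_dext : forall x, dext star_calc (fstar x) = fstar (dext star_calc x) ;
    fstarM : forall k l x y, Omk star_calc k x -> Omk star_calc l y ->
      fstar (x * y) = (-1) ^+ (k * l) * (fstar y * fstar x)
  }.

(* The decomposition is by pairs (p, q); [prpq p q] is the projection
   \pi^(p,q) of the total algebra onto Omega^(p,q). *)
Record complex_structure (C : numClosedFieldType) (B : starAlgType C)
    (Cal : star_calculus B) := ComplexStructure {
  Om : nat -> nat -> subbimod (iotaB Cal) ;
  prpq : nat -> nat -> {linear Cal -> Cal} ;
  Om_sum : direct_sum (fun pq : nat * nat => subbimod_set (Om pq.1 pq.2))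
                      (fun pq => prpq pq.1 pq.2) ;
  OmM : forall p q p' q' x y,
    Om p q x -> Om p' q' y -> Om (p + p') (q + q') (x * y) ;
  Om_deg : forall k x,
    Omk Cal k x <->
    exists y : 'I_k.+1 -> Cal,
      (forall p : 'I_k.+1, Om p (k - p) (y p)) /\ x = \sum_p y p ;
  Om_star : forall p q x, Om p q x -> Om q p (fstar x) ;
  Om_dext : forall p q x, Om p q x ->
    exists y z, [/\ Om p.+1 q y, Om p q.+1 z & dext Cal x = y + z]
}.

Section CalculusTheory.
Variables (C : numClosedFieldType) (B : starAlgType C).
Variable Cal : star_calculus B.

Definition Omega1 : bimodType B := forms (Omk Cal 1).

Lemma iotaB_deg0 b : Omk Cal 0 (iotaB Cal b).
Proof. by apply/Omk0; exists b. Qed.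

Definition d0 (b : B) : Omega1 := mkform (dext_deg (iotaB_deg0 b)).

Definition star_form k (x : forms (Omk Cal k)) : forms (Omk Cal k) :=
  mkform (fstar_deg (form_in x)).

Lemma star_formD k (x y : forms (Omk Cal k)) :
  star_form (x + y) = star_form x + star_form y.
Proof. by apply: form_eq; apply: fstarD. Qed.

Lemma star_formZr k (x : forms (Omk Cal k)) b :
  star_form (x :* b) = star b *: star_form x.
Proof.
apply: form_eq; rewrite form_valZl /= -fstar_iotaB.
by rewrite (fstarM (form_in x) (iotaB_deg0 b)) muln0 expr0 mul1r.
Qed.

Variable X : complex_structure Cal.

Lemma Om00 x : Om X 0 0 x <-> Omk Cal 0 x.
Proof.
rewrite (Om_deg X); split=> [Xx|[y [yP ->]]].
  by exists (fun=> x); split=> [p|]; rewrite ?big_ord1 // ord1.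
by rewrite big_ord1; apply: (yP ord0).
Qed.

Lemma Om_Omk p q x : Om X p q x -> Omk Cal (p + q) x.
Proof.
move=> Xx; rewrite (Om_deg X).
exists (fun i => if (i : nat) == p then x else 0); split=> [i|].
  by case: eqP => [->|_]; [rewrite addKn | apply: subbimod0].
have ip : (p < (p + q).+1)%N by rewrite ltnS leq_addr.
rewrite (bigD1 (Ordinal ip)) //= eqxx big1 ?addr0 // => i.
by rewrite -val_eqE /= => /negPf ->.
Qed.

Lemma prpqZl p q b x :
  prpq X p q (iotaB Cal b * x) = iotaB Cal b * prpq X p q x.
Proof.
have [s [_ xE]] := pr_sum (Om_sum X) x.
rewrite xE mulr_sumr !linear_sum mulr_sumr; apply: eq_bigr => i _.
have Xi := pr_in (Om_sum X) i x.
have bXi := subbimodZl b Xi.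
have [ipq|ipq] := eqVneq (p, q) i.
  have -> : p = i.1 by rewrite -ipq. have -> : q = i.2 by rewrite -ipq.
  by rewrite (pr_id (Om_sum X) bXi) (pr_id (Om_sum X) Xi).
by rewrite (pr_ne (Om_sum X) bXi ipq) (pr_ne (Om_sum X) Xi ipq) mulr0.
Qed.

Lemma prpqZr p q b x :
  prpq X p q (x * iotaB Cal b) = prpq X p q x * iotaB Cal b.
Proof.
have [s [_ xE]] := pr_sum (Om_sum X) x.
rewrite xE mulr_suml !linear_sum mulr_suml; apply: eq_bigr => i _.
have Xi := pr_in (Om_sum X) i x.
have bXi := subbimodZr b Xi.
have [ipq|ipq] := eqVneq (p, q) i.
  have -> : p = i.1 by rewrite -ipq. have -> : q = i.2 by rewrite -ipq.
  by rewrite (pr_id (Om_sum X) bXi) (pr_id (Om_sum X) Xi).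
by rewrite (pr_ne (Om_sum X) bXi ipq) (pr_ne (Om_sum X) Xi ipq) mul0r.
Qed.

Definition pr_form p q (x : Cal) : forms (Om X p q) :=
  mkform (pr_in (Om_sum X) (p, q) x).

Section ProjIncl.
Variables (k p q : nat).

Definition proj_fun (x : forms (Omk Cal k)) : forms (Om X p q) :=
  pr_form p q (form_val x).

Lemma proj_fun_linear : linear proj_fun.
Proof.
move=> b x y; apply: form_eq.
apply: etrans (linearD (prpq X p q) _ _) _.
by congr (_ + _); apply: prpqZl.
Qed.

HB.instance Definition _ := GRing.isLinear.Build B
  (forms (Omk Cal k)) (forms (Om X p q)) _ proj_fun proj_fun_linear.

Lemma proj_fun_ract x b : proj_fun (x :* b) = proj_fun x :* b.
Proof. by apply: form_eq; apply: prpqZr. Qed.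

Definition pi_hom : bimodHom (forms (Omk Cal k)) (forms (Om X p q)) :=
  BimodHom proj_fun_ract.

Definition incl_fun (x : forms (Om X p q)) : forms (Omk Cal (p + q)) :=
  mkform (Om_Omk (form_in x)).

Lemma incl_fun_linear : linear incl_fun.
Proof. by move=> b x y; apply: form_eq. Qed.

HB.instance Definition _ := GRing.isLinear.Build B
  (forms (Om X p q)) (forms (Omk Cal (p + q))) _ incl_fun incl_fun_linear.

Lemma incl_fun_ract x b : incl_fun (x :* b) = incl_fun x :* b.
Proof. by apply: form_eq. Qed.

Definition incl_hom : bimodHom (forms (Om X p q)) (forms (Omk Cal (p + q))) :=
  BimodHom incl_fun_ract.

End ProjIncl.

Definition del p q (x : forms (Om X p q)) : forms (Om X p.+1 q) :=
  pr_form p.+1 q (dext Cal (form_val x)).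

Definition delbar p q (x : forms (Om X p q)) : forms (Om X p q.+1) :=
  pr_form p q.+1 (dext Cal (form_val x)).

Lemma mul_in_l p q x y : Om X 0 q x -> Om X p 0 y -> Om X p q (x * y).
Proof. by move=> Xx Xy; have := OmM Xx Xy; rewrite addn0. Qed.

Lemma mul_in_r p q x y : Om X p 0 x -> Om X 0 q y -> Om X p q (x * y).
Proof. by move=> Xx Xy; have := OmM Xx Xy; rewrite addn0. Qed.

Definition mul_l p q (x : forms (Om X 0 q)) (y : forms (Om X p 0)) :
  forms (Om X p q) := mkform (mul_in_l (form_in x) (form_in y)).

Definition mul_r p q (x : forms (Om X p 0)) (y : forms (Om X 0 q)) :
  forms (Om X p q) := mkform (mul_in_r (form_in x) (form_in y)).

Lemma mul_l_balanced p q : balanced (@mul_l p q).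
Proof.
split=> *; apply: form_eq; [exact: mulrDl | exact: mulrDr |].
exact: esym (mulrA _ _ _).
Qed.

Lemma mul_r_balanced p q : balanced (@mul_r p q).
Proof.
split=> *; apply: form_eq; [exact: mulrDl | exact: mulrDr |].
exact: esym (mulrA _ _ _).
Qed.

Definition wedge_l p q :
    tens (forms (Om X 0 q)) (forms (Om X p 0)) -> forms (Om X p q) :=
  tlift (@mul_l_balanced p q).

Definition wedge_r p q :
    tens (forms (Om X p 0)) (forms (Om X 0 q)) -> forms (Om X p q) :=
  tlift (@mul_r_balanced p q).

Definition factorizable :=
  forall p q, bijective (@wedge_l p q) /\ bijective (@wedge_r p q).

(* Inverses of the wedge maps; meaningful when X is factorizable. *)
Definition theta_l p q (x : forms (Om X p q)) :
    tens (forms (Om X 0 q)) (forms (Om X p 0)) :=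
  xget 0 [set t | wedge_l t = x]%classic.

Definition theta_r p q (x : forms (Om X p q)) :
    tens (forms (Om X p 0)) (forms (Om X 0 q)) :=
  xget 0 [set t | wedge_r t = x]%classic.

Lemma wedge_lK : factorizable ->
  forall p q, cancel (@wedge_l p q) (@theta_l p q) /\
              cancel (@theta_l p q) (@wedge_l p q).
Proof.
move=> fac p q; have [[g gK Kg] _] := fac p q.
have Kt : cancel (@theta_l p q) (@wedge_l p q).
  move=> x; have wx : exists t, [set t | wedge_l t = x]%classic t.
    by exists (g x); apply: Kg.
  exact: (xgetPex 0 wx).
by split=> // t; apply: (can_inj gK); rewrite Kt.
Qed.

Lemma wedge_rK : factorizable ->
  forall p q, cancel (@wedge_r p q) (@theta_r p q) /\
              cancel (@theta_r p q) (@wedge_r p q).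
Proof.
move=> fac p q; have [_ [g gK Kg]] := fac p q.
have Kt : cancel (@theta_r p q) (@wedge_r p q).
  move=> x; have wx : exists t, [set t | wedge_r t = x]%classic t.
    by exists (g x); apply: Kg.
  exact: (xgetPex 0 wx).
by split=> // t; apply: (can_inj gK); rewrite Kt.
Qed.

Lemma op_sum : direct_sum
  (fun pq : nat * nat => subbimod_set (Om X pq.2 pq.1))
  (fun pq => prpq X pq.2 pq.1).
Proof.
case: (Om_sum X) => pin pid pne psum; split=> [i x|i x|i j x|x].
- exact: (pin (i.2, i.1)).
- exact: (pid (i.2, i.1)).
- move=> Xx ji; apply: (pne (i.2, i.1) (j.2, j.1)) => //.
  by apply: contra ji; rewrite !xpair_eqE andbC.
- have [s [us xE]] := psum x; exists [seq (i.2, i.1) | i <- s]; split.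
    by rewrite map_inj_uniq // => -[a b] [c e] /= [-> ->].
  by rewrite big_map.
Qed.

Lemma op_M p q p' q' x y :
  Om X q p x -> Om X q' p' y -> Om X (q + q') (p + p') (x * y).
Proof. exact: OmM. Qed.

Lemma op_deg k x :
  Omk Cal k x <->
  exists y : 'I_k.+1 -> Cal,
    (forall p : 'I_k.+1, Om X (k - p) p (y p)) /\ x = \sum_p y p.
Proof.
rewrite (Om_deg X); split=> -[y [yP ->]].
  exists (fun p => y (rev_ord p)); split=> [p|].
    have := yP (rev_ord p); rewrite /= subSS subKn //; exact: leq_ord.
  by rewrite (reindex_inj rev_ord_inj).
exists (fun p => y (rev_ord p)); split=> [p|].
  have := yP (rev_ord p); rewrite /= subSS subKn //; exact: leq_ord.
by rewrite (reindex_inj rev_ord_inj).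
Qed.

Lemma op_dext p q x : Om X q p x ->
  exists y z, [/\ Om X q p.+1 y, Om X q.+1 p z & dext Cal x = y + z].
Proof.
move=> /Om_dext[y [z [Xy Xz ->]]]; exists z, y; split=> //; exact: addrC.
Qed.

(* [Om op_cs p q] is convertible to [Om X q p], so that the same form types
   serve for X and for [op_cs]. *)
Definition op_cs : complex_structure Cal :=
  @ComplexStructure C B Cal (fun p q => Om X q p) (fun p q => prpq X q p)
    op_sum op_M op_deg (fun p q => @Om_star _ _ _ X q p) op_dext.

Section Connections.
Variable E : bimodType B.

Record left_connection (nabla : E -> tens Omega1 E) : Prop := LeftConnection {
  conn_lin : Clinear nabla ;
  conn_leibniz : forall b e, nabla (b *: e) = b *: nabla e + tpure (d0 b) e
}.

Definition bimodule_connection (nabla : E -> tens Omega1 E) : Prop :=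
  left_connection nabla /\
  exists sigma : bimodHom (tens E Omega1) (tens Omega1 E),
    forall e b, nabla (e :* b) = nabla e :* b + sigma (tpure e (d0 b)).

Variable H : hermitian_metric E.

(* (id (x) < , >) (- (x) \bar f) : Omega^1 (x) E -> Omega^1 *)
Lemma contr_l_balanced (f : conjm E) :
  balanced (fun (w : Omega1) (x : E) => w :* pairing H x f).
Proof.
split=> [w w' x|w x x'|w b x]; first exact: ractDl.
  by rewrite pairingDl ractDr.
by rewrite pairingZl ractM.
Qed.

Definition contr_l (f : conjm E) : tens Omega1 E -> Omega1 :=
  tlift (contr_l_balanced f).

(* (< , > (x) id) (e (x) -) : \bar E (x) Omega^1 -> Omega^1 *)
Lemma contr_r_balanced (e : E) :
  balanced (fun (x : conjm E) (w : Omega1) => pairing H e x *: w).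
Proof.
split=> [x x' w|x w w'|x b w]; last 1 first.
- by rewrite pairingZr scalerA.
- by rewrite pairingDr scalerDl.
- exact: scalerDr.
Qed.

Definition contr_r (e : E) : tens (conjm E) Omega1 -> Omega1 :=
  tlift (contr_r_balanced e).

(* w (x) x |-> \bar x (x) w^* *)
Lemma conj_flip_balanced :
  balanced (fun (w : Omega1) (x : E) => tpure (bar x) (star_form w)).
Proof.
split=> [w w' x|w x x'|w b x].
- by rewrite star_formD tpureDr.
- exact: tpureDl.
- rewrite star_formZr -tpureM; congr tpure.
  by rewrite [LHS]/(star (star b) *: x) starK.
Qed.

Definition conj_flip : tens Omega1 E -> tens (conjm E) Omega1 :=
  tlift conj_flip_balanced.

Definition metric_compatible (nabla : E -> tens Omega1 E) : Prop :=
  forall e f : E,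
    d0 (pairing H e (bar f)) =
    contr_l (bar f) (nabla e) + contr_r e (conj_flip (nabla f)).

(* The properties that determine the Chern connection uniquely. *)
Record is_chern (dbarE : E -> tens (forms (Om X 0 1)) E)
    (nabla : E -> tens Omega1 E) : Prop := IsChern {
  chern_conn : left_connection nabla ;
  chern_compat : metric_compatible nabla ;
  chern_01 : forall e, tmap (pi_hom 1 0 1) (bimod_id E) (nabla e) = dbarE e
}.

End Connections.

Definition dbar_10 (w : forms (Om X 1 0)) :
    tens (forms (Om X 0 1)) (forms (Om X 1 0)) := theta_l (delbar w).

Definition del_01 (w : forms (Om X 0 1)) :
    tens (forms (Om X 1 0)) (forms (Om X 0 1)) := theta_r (del w).

(* The summands take values in Omega^1 (x) Omega^(1,0) and in
   Omega^1 (x) Omega^(0,1), whence the inclusions on the second factor. *)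
Definition sum_connection
    (nabla1 : forms (Om X 1 0) -> tens Omega1 (forms (Om X 1 0)))
    (nabla2 : forms (Om X 0 1) -> tens Omega1 (forms (Om X 0 1)))
    (w : Omega1) : tens Omega1 Omega1 :=
  tmap (bimod_id Omega1) (incl_hom 1 0) (nabla1 (pi_hom 1 1 0 w)) +
  tmap (bimod_id Omega1) (incl_hom 0 1) (nabla2 (pi_hom 1 0 1 w)).

End CalculusTheory.

Section Opposite.
Variables (C : numClosedFieldType) (B : starAlgType C).
Variables (Cal : star_calculus B) (X : complex_structure Cal).

Lemma op_del p q (w : forms (Om X q p)) :
  del (X := op_cs X) (p := p) (q := q) w = delbar w.
Proof. exact: form_eq. Qed.

Lemma op_delbar p q (w : forms (Om X q p)) :
  delbar (X := op_cs X) (p := p) (q := q) w = del w.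
Proof. exact: form_eq. Qed.

Lemma op_wedge_l p q (t : tens (forms (Om X q 0)) (forms (Om X 0 p))) :
  wedge_l (X := op_cs X) (p := p) (q := q) t = wedge_r t.
Proof. by apply: eq_bigr => i _; apply: form_eq. Qed.

Lemma op_dbar_10 (w : forms (Om X 0 1)) :
  dbar_10 (X := op_cs X) w = del_01 w.
Proof.
rewrite /dbar_10 /del_01 /theta_l /theta_r op_delbar.
by congr xget; apply/seteqP; split=> t /=; rewrite op_wedge_l.
Qed.

End Opposite.

(* Main.v *)
Require Import Defs.
From HB Require Import structures.
From mathcomp Require Import all_boot all_order all_algebra.
From mathcomp Require Import reals complex.

(** Let E be [Omega^(1,0)] with its Chern connection [nabla].  Being a bimodule
connection is a statement about the defect
[D(e, b) = nabla(e b) - (nabla e) b]: it has to be [sigma(e (x) db)] for one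
bimodule map [sigma].  The two halves of [Omega^1] are treated separately.

The (0,1)-half of [nabla] is [theta_l o delbar].  The Leibniz rule for a form
of degree one gives [delbar(e b) = (delbar e) b - e /\ delbar b], so the
(0,1)-half of [D(e, b)] is [S(e (x) db)], where
[S = - theta_l o /\ o (id (x) pi^(0,1))] is a bimodule map
([dbar_10_ract]).

The (1,0)-half is controlled by the metric.  Write [b'] and [w'] for adjoints.
Compatibility at [(e b, f)] and at [(e, f b')], where the left-hand sides agree,
gives by subtraction [<D(e, b), \bar f> = <e, \bar{D(f, b')}>]
([metric_defect]).  Conjugation exchanges types, so the (1,0)-half of [D(e, b)]
is determined by the (0,1)-half of [D(f, b')], which is [S(f (x) db')].  It is
therefore the value at [e (x) db] of the transpose of [S] for the metric: the
map [T] with [<T(e (x) w), \bar f> = <e, \bar{S(f (x) w')}>].  Such a [T] exists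
and is unique because E, a direct summand of [Omega^1], is finitely generated
projective: the metric turns a dual basis of E into vectors [x_i], [f_i] with
[e = sum_i <e, \bar f_i> x_i], and an element of [Omega^1 (x) E] may be
prescribed freely by its pairings with all [\bar f], subject to linearity.
Uniqueness yields every algebraic property of [T], and [sigma = S + T]
([metric_bimodule_connection], [chern_bimodule_connection]).

The opposite complex structure is factorizable as well, and its holomorphic
structure on [Omega^(0,1)] is [theta_r o del], so the same result covers the
second Chern connection.  Finally a direct sum of bimodule connections is a
bimodule connection ([sum_bimodule_connection]). *)

Set Implicit Arguments.
Unset Strict Implicit.
Unset Printing Implicit Defensive.

Import GRing.Theory.
Local Open Scope ring_scope.

(** * Bimodule maps and tensor products *)

Section BimodHom.
Variables (C : numClosedFieldType) (B : algType C).
Implicit Types (M N P : bimodType B).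

Definition bimod_mk M N (f : M -> N) (fD : {morph f : x y / x + y})
    (fZ : forall b m, f (b *: m) = b *: f m)
    (fR : forall m b, f (m :* b) = f m :* b) : bimodHom M N :=
  let lin : linear f := fun a u v =>
    etrans (fD _ _) (congr1 (+%R^~ (f v)) (fZ a u)) in
  @BimodHom C B M N
    (HB.pack_for {linear M -> N} f (GRing.isLinear.Build B M N _ f lin)) fR.

Definition bimod_comp M N P (g : bimodHom N P) (f : bimodHom M N) :
  bimodHom M P.
Proof.
apply: (@bimod_mk _ _ (fun m => g (f m))) => [x y|b m|m b].
- by rewrite !linearD.
- by rewrite !linearZ.
- by rewrite !bimod_funP.
Defined.

Definition bimod_add M N (f g : bimodHom M N) : bimodHom M N.
Proof.
apply: (@bimod_mk _ _ (fun m => f m + g m)) => [x y|b m|m b].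
- by rewrite !linearD addrACA.
- by rewrite !linearZ scalerDr.
- by rewrite !bimod_funP ractDl.
Defined.

Lemma bimod_addE M N (f g : bimodHom M N) m : bimod_add f g m = f m + g m.
Proof. by []. Qed.

Definition bimod_opp M N (f : bimodHom M N) : bimodHom M N.
Proof.
apply: (@bimod_mk _ _ (fun m => - f m)) => [x y|b m|m b].
- by rewrite linearD opprD.
- by rewrite linearZ scalerN.
- by rewrite bimod_funP ractNl.
Defined.

Definition bimod_inv M N (f : bimodHom M N) (g : N -> M)
  (fK : cancel f g) (gK : cancel g f) : bimodHom N M.
Proof.
apply: (@bimod_mk _ _ g) => [x y|b m|m b]; apply: (can_inj fK).
- by rewrite linearD !gK.
- by rewrite linearZ !gK.
- by rewrite bimod_funP !gK.
Defined.

Lemma tens_ind M N (Q : tens M N -> Prop) :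
  (forall m n, Q (tpure m n)) -> (forall x y, Q x -> Q y -> Q (x + y)) ->
  forall x, Q x.
Proof.
move=> Qp QD x; rewrite (tens_sum x); elim/big_ind: _ => //.
have <- : tpure (0 : M) (0 : N) = 0; last exact: Qp.
by apply: (addrI (tpure 0 0)); rewrite -tpureDl !addr0.
Qed.

Lemma tpureDr_sum M N I (r : seq I) (m : M) (n : I -> N) :
  tpure m (\sum_(i <- r) n i) = \sum_(i <- r) tpure m (n i).
Proof.
elim/big_rec2: _ => [|i y z _ <-]; last exact: tpureDr.
by apply: (addrI (tpure m 0)); rewrite -tpureDr !addr0.
Qed.

Definition tlift_hom M N P (f : M -> N -> P) (fB : balanced f)
  (fZ : forall b m n, f (b *: m) n = b *: f m n)
  (fR : forall m n b, f m (n :* b) = f m n :* b) : bimodHom (tens M N) P.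
Proof.
apply: (@bimod_mk _ _ (tlift fB)) => [|b|t b]; first exact: tliftD.
- elim/tens_ind=> [m n|x y xE yE]; first by rewrite tpureZl !tliftE.
  by rewrite scalerDr !tliftD xE yE scalerDr.
- elim/tens_ind: t => [m n|x y xE yE]; first by rewrite tpureZr !tliftE.
  by rewrite ractDl !tliftD xE yE ractDl.
Defined.

Lemma tlift_homE M N P f fB fZ fR m n :
  @tlift_hom M N P f fB fZ fR (tpure m n) = f m n.
Proof. exact: tliftE. Qed.

Definition tmap_hom M M' N N' (f : bimodHom M M') (g : bimodHom N N') :
  bimodHom (tens M N) (tens M' N').
Proof.
apply: (tlift_hom (tmap_balanced f g)) => [b m n|m n b].
- by rewrite linearZ tpureZl.
- by rewrite bimod_funP tpureZr.
Defined.

Lemma tmap_pure M M' N N' (f : bimodHom M M') (g : bimodHom N N') m n :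
  tmap f g (tpure m n) = tpure (f m) (g n).
Proof. exact: tliftE. Qed.

Lemma tmapD M M' N N' (f : bimodHom M M') (g : bimodHom N N') t u :
  tmap f g (t + u) = tmap f g t + tmap f g u.
Proof. exact: tliftD. Qed.

Lemma tmap_compl M M' M2 N (f : bimodHom M' M2) (f' : bimodHom M M')
    (t : tens M N) :
  tmap (bimod_comp f f') (bimod_id N) t =
  tmap f (bimod_id N) (tmap f' (bimod_id N) t).
Proof.
by elim/tens_ind: t => [m n|t u tE uE]; rewrite ?tmap_pure // !tmapD tE uE.
Qed.

End BimodHom.

(** * Linearity of the metric contractions *)

Section Contractions.
Variables (C : numClosedFieldType) (B : starAlgType C).
Variables (Cal : star_calculus B) (E : bimodType B) (H : hermitian_metric E).
Implicit Types (e : E) (f : conjm E) (b : B) (t : tens (Omega1 Cal) E).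
Implicit Types (u : tens (conjm E) (Omega1 Cal)).

Lemma contr_lD f t t' : contr_l H f (t + t') = contr_l H f t + contr_l H f t'.
Proof. exact: tliftD. Qed.

Lemma contr_lZ f b t : contr_l H f (b *: t) = b *: contr_l H f t.
Proof.
elim/tens_ind: t => [w x|x y xE yE].
  by rewrite tpureZl /contr_l !tliftE lractA.
by rewrite scalerDr !contr_lD xE yE scalerDr.
Qed.

Lemma contr_l_ract f b t : contr_l H f (t :* b) = contr_l H (b *: f) t.
Proof.
elim/tens_ind: t => [w x|x y xE yE].
  by rewrite tpureZr /contr_l !tliftE pairingM.
by rewrite ractDl !contr_lD xE yE.
Qed.

Lemma contr_rD e u u' : contr_r H e (u + u') = contr_r H e u + contr_r H e u'.
Proof. exact: tliftD. Qed.

Lemma contr_r_ract e b u : contr_r H e (u :* b) = contr_r H e u :* b.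
Proof.
elim/tens_ind: u => [x w|x y xE yE].
  by rewrite tpureZr /contr_r !tliftE lractA.
by rewrite ractDl !contr_rD xE yE ractDl.
Qed.

Lemma contr_r_lact e b u : contr_r H e (b *: u) = contr_r H (e :* b) u.
Proof.
elim/tens_ind: u => [x w|x y xE yE].
  by rewrite tpureZl /contr_r !tliftE pairingM.
by rewrite scalerDr !contr_rD xE yE.
Qed.

Lemma contr_rZ e b u : contr_r H (b *: e) u = b *: contr_r H e u.
Proof.
elim/tens_ind: u => [x w|x y xE yE].
  by rewrite /contr_r !tliftE pairingZl scalerA.
by rewrite !contr_rD xE yE scalerDr.
Qed.

Lemma contr_rDl e e' u : contr_r H (e + e') u = contr_r H e u + contr_r H e' u.
Proof.
elim/tens_ind: u => [x w|x y xE yE].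
  by rewrite /contr_r !tliftE pairingDl scalerDl.
by rewrite !contr_rD xE yE addrACA.
Qed.

Lemma star_formZl k b (x : forms (Omk Cal k)) :
  star_form (b *: x) = star_form x :* star b.
Proof.
apply: form_eq; rewrite form_valZr /= -fstar_iotaB.
by rewrite (fstarM (iotaB_deg0 Cal b) (form_in x)) mul0n expr0 mul1r.
Qed.

Lemma conj_flipD t t' : conj_flip (t + t') = conj_flip t + conj_flip t'.
Proof. exact: tliftD. Qed.

Lemma conj_flipZ b t : conj_flip (b *: t) = conj_flip t :* star b.
Proof.
elim/tens_ind: t => [w x|x y xE yE].
  by rewrite tpureZl /conj_flip !tliftE star_formZl tpureZr.
by rewrite scalerDr !conj_flipD xE yE ractDl.
Qed.

Lemma conj_flip_ract b t : conj_flip (t :* b) = star b *: conj_flip t.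
Proof.
elim/tens_ind: t => [w x|x y xE yE].
  rewrite tpureZr /conj_flip !tliftE tpureZl; congr tpure.
  by rewrite [RHS]/((x : E) :* star (star b)) starK.
by rewrite ractDl !conj_flipD xE yE scalerDr.
Qed.

End Contractions.

(** * Dual bases given by a Hermitian metric *)

Section Frames.
Variables (C : numClosedFieldType) (B : starAlgType C).
Variables (E : bimodType B) (H : hermitian_metric E).

(** The Hermitian metric identifies [\bar E] with the left dual of E, so this is
a dual basis of E whose coordinate functions are written as [<-, \bar f_i>]. *)
Definition metric_frame n (x f : 'I_n -> E) :=
  forall e, e = \sum_i pairing H e (bar (f i)) *: x i.

Lemma pairing_star (e g : E) :
  star (pairing H e (bar g)) = pairing H g (bar e).
Proof. exact: hm_sym. Qed.

Lemma pairing_inj (g g' : E) :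
  (forall e, pairing H e (bar g) = pairing H e (bar g')) -> g = g'.
Proof.
by move=> gg'; apply: (bij_inj (hm_bij H)); apply: ldualP => e; apply: gg'.
Qed.

Lemma pairing_suml I (r : seq I) (c : I -> B) (x : I -> E) g :
  pairing H (\sum_(i <- r) c i *: x i) g =
  \sum_(i <- r) c i * pairing H (x i) g.
Proof.
elim/big_rec2: _ => [|i y z _ <-]; last by rewrite pairingDl pairingZl.
by rewrite -[X in pairing H X](scale0r (0 : E)) pairingZl mul0r.
Qed.

Lemma pairing_sumr I (r : seq I) (c : I -> B) (x : I -> E) e :
  pairing H e (bar (\sum_(i <- r) c i *: x i)) =
  \sum_(i <- r) pairing H e (bar (x i)) * star (c i).
Proof.
elim/big_rec2: _ => [|i y z _ <-]; first by rewrite /pairing (linear0 (hm H)).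
rewrite -pairingZr -pairingDr; congr (pairing H e (_ + _)).
by rewrite [RHS]/(star (star (c i)) *: (x i : E)) starK.
Qed.

(** By Hermitian symmetry: both sides have the same pairings with every [e], as
one sees by expanding [e] in the frame. *)
Lemma metric_frame_sym n (x f : 'I_n -> E) :
  metric_frame x f -> metric_frame f x.
Proof.
move=> xf g; apply: pairing_inj => e.
rewrite {1}(xf e) pairing_suml pairing_sumr; apply: eq_bigr => i _.
by rewrite pairing_star.
Qed.

(** A section of the presentation [B^n -> M] gives a dual basis of M.  It
restricts to the summand E, and surjectivity of the metric represents the
coordinate functions. *)
Lemma metric_frame_exists (M : bimodType B) (s : bimodHom E M)
    (p : bimodHom M E) :
  cancel s p -> finitely_generated M -> projective M ->
  exists n (x f : 'I_n -> E), metric_frame x f.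
Proof.
move=> sK [n [g gP]] Mproj.
pose comb (c : {ffun 'I_n -> B^o}) : M := \sum_i (c i : B) *: g i.
have comb_lin : linear comb.
  move=> b c c'; rewrite /comb scaler_sumr -big_split /=.
  apply: eq_bigr => i _.
  by rewrite !ffunE scalerDl scalerA.
pose combL : {linear {ffun 'I_n -> B^o} -> M} := HB.pack_for
  {linear {ffun 'I_n -> B^o} -> M} comb
  (GRing.isLinear.Build B {ffun 'I_n -> B^o} M _ comb comb_lin).
have comb_surj m : exists c, combL c = m.
  have [c ->] := gP m; exists [ffun i => c i].
  by apply: eq_bigr => i _; rewrite ffunE.
have [q qP] := Mproj _ _ combL idfun comb_surj.
have coordD i : {morph (fun e => q (s e) i) : e e' / e + e'}.
  by move=> e e'; rewrite !linearD ffunE.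
have coordZ i b e : q (s (b *: e)) i = b * q (s e) i.
  by rewrite !linearZ ffunE.
have [hinv _ hinvK] := hm_bij H.
pose coord i : ldual E := ldual_mk (coordD i) (coordZ i).
exists n, (fun i => p (g i)), (fun i => hinv (coord i)) => e.
rewrite -{1}(sK e) -[s e]qP linear_sum; apply: eq_bigr => i _.
by rewrite linearZ /pairing hinvK.
Qed.

End Frames.

(** * Metric connections whose half is a bimodule connection *)

Section MetricBimoduleConnection.
Variables (C : numClosedFieldType) (B : starAlgType C).
Variables (Cal : star_calculus B) (E : bimodType B) (H : hermitian_metric E).
Variables (n : nat) (x f : 'I_n -> E) (xf : metric_frame H x f).

Lemma contr_l_frame (t : tens (Omega1 Cal) E) :
  t = \sum_i tpure (contr_l H (bar (f i)) t) (x i).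
Proof.
elim/tens_ind: t => [w e|t u tE uE].
  rewrite {1}(xf e) tpureDr_sum; apply: eq_bigr => i _.
  by rewrite -tpureM /contr_l tliftE.
rewrite {1}tE {1}uE -big_split; apply: eq_bigr => i _.
by rewrite contr_lD tpureDl.
Qed.

(** Pairings with E separate the points of [Omega^1 (x) E].  Identities in this
tensor product, including the linearity of maps into it, are checked below after
pairing. *)
Lemma contr_l_inj (t u : tens (Omega1 Cal) E) :
  (forall g : E, contr_l H (bar g) t = contr_l H (bar g) u) -> t = u.
Proof.
move=> tu; rewrite (contr_l_frame t) (contr_l_frame u).
by apply: eq_bigr => i _; rewrite tu.
Qed.

Section Transpose.
Variable S : bimodHom (tens E (Omega1 Cal)) (tens (Omega1 Cal) E).

(* The pairing with [\bar g] prescribed for the transpose at [e (x) w]. *)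
Let phi (e : E) (w : Omega1 Cal) (g : E) : Omega1 Cal :=
  contr_r H e (conj_flip (S (tpure g (star_form w)))).

Let phiZ e w b g : phi e w (b *: g) = phi e w g :* star b.
Proof. by rewrite /phi -tpureZl linearZ conj_flipZ contr_r_ract. Qed.

Let phiDr e w g g' : phi e w (g + g') = phi e w g + phi e w g'.
Proof. by rewrite /phi tpureDl linearD conj_flipD contr_rD. Qed.

Let phi_sum e w I (r : seq I) (c : I -> B) (y : I -> E) :
  phi e w (\sum_(i <- r) c i *: y i) =
  \sum_(i <- r) phi e w (y i) :* star (c i).
Proof.
elim/big_rec2: _ => [|i y1 y2 _ <-]; last by rewrite phiDr phiZ.
by apply: (addrI (phi e w 0)); rewrite -phiDr !addr0.
Qed.

Let transpose_fun (e : E) (w : Omega1 Cal) : tens (Omega1 Cal) E :=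
  \sum_i tpure (phi e w (f i)) (x i).

Let contr_l_transpose_fun e w g :
  contr_l H (bar g) (transpose_fun e w) = phi e w g.
Proof.
(* The values of [phi e w] at the [f i] are known, so [g] is expanded in them. *)
rewrite [in RHS](metric_frame_sym xf g) phi_sum /transpose_fun.
elim/big_rec2: _ => [|i y1 y2 _ <-].
  by apply: (addrI (contr_l H (bar g) 0)); rewrite -contr_lD !addr0.
by rewrite contr_lD pairing_star /contr_l tliftE.
Qed.

Let transpose_balanced : balanced transpose_fun.
Proof.
split=> [e e' w|e w w'|e b w]; apply: contr_l_inj => g;
  rewrite ?contr_lD !contr_l_transpose_fun /phi.
- exact: contr_rDl.
- by rewrite star_formD tpureDr linearD conj_flipD contr_rD.
- by rewrite star_formZl -tpureZr bimod_funP conj_flip_ract starK contr_r_lact.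
Qed.

(** The map [T] characterised by [contr_l_metric_transpose], namely
[<T(e (x) w), \bar g> = <e, \bar{S(g (x) w')}>] with [w'] the adjoint of [w]. *)
Definition metric_transpose :
  bimodHom (tens E (Omega1 Cal)) (tens (Omega1 Cal) E).
Proof.
apply: (tlift_hom transpose_balanced) => [b e w|e w b];
  apply: contr_l_inj => g.
- by rewrite contr_lZ !contr_l_transpose_fun /phi contr_rZ.
- rewrite contr_l_ract contr_l_transpose_fun.
  rewrite -[b *: bar g]/(bar (g :* star b)) contr_l_transpose_fun /phi.
  by rewrite star_formZr tpureM.
Defined.

Lemma contr_l_metric_transpose e w g :
  contr_l H (bar g) (metric_transpose (tpure e w)) =
  contr_r H e (conj_flip (S (tpure g (star_form w)))).
Proof. by rewrite tlift_homE contr_l_transpose_fun. Qed.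

End Transpose.

Lemma d0_star b : d0 Cal (star b) = star_form (d0 Cal b).
Proof. by apply: form_eq; rewrite /= -fstar_iotaB fstar_dext. Qed.

Lemma contr_l_tmap (P : bimodHom (Omega1 Cal) (Omega1 Cal)) g t :
  contr_l H g (tmap P (bimod_id E) t) = P (contr_l H g t).
Proof.
elim/tens_ind: t => [w e|t u tE uE].
  by rewrite tmap_pure /contr_l !tliftE bimod_funP.
by rewrite tmapD !contr_lD tE uE linearD.
Qed.

Lemma contr_r_tmap (P P' : bimodHom (Omega1 Cal) (Omega1 Cal)) e t :
  (forall w, P' (star_form w) = star_form (P w)) ->
  contr_r H e (conj_flip (tmap P (bimod_id E) t)) =
  P' (contr_r H e (conj_flip t)).
Proof.
move=> PP'; elim/tens_ind: t => [w g|t u tE uE].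
  by rewrite tmap_pure /conj_flip !tliftE /contr_r !tliftE linearZ PP'.
by rewrite tmapD !conj_flipD !contr_rD tE uE linearD.
Qed.

(** Since [e b] and [g] pair like [e] and [g (star b)], compatibility at
[(e b, g)] and at [(e, g (star b))] computes the same differential in two ways;
their difference relates the failures of right linearity at [e] and at [g]. *)
Lemma metric_defect (nabla : E -> tens (Omega1 Cal) E) e b g :
  metric_compatible H nabla ->
  contr_l H (bar g) (nabla (e :* b) - nabla e :* b) =
  contr_r H e (conj_flip (nabla (g :* star b) - nabla g :* star b)).
Proof.
move=> comp.
have cl t u : contr_l H (bar g) (t - u) =
    contr_l H (bar g) t - contr_l H (bar g) u.
  by apply: (canRL (addrK _)); rewrite -contr_lD subrK.
have cr t u : contr_r H e (conj_flip (t - u)) =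
    contr_r H e (conj_flip t) - contr_r H e (conj_flip u).
  by apply: (canRL (addrK _)); rewrite -contr_rD -conj_flipD subrK.
have := comp (e :* b) g; have := comp e (g :* star b).
rewrite cl cr contr_l_ract conj_flip_ract starK contr_r_lact pairingM.
rewrite -[b *: bar g]/(bar (g :* star b)) => -> AB.
by apply/eqP; rewrite subr_eq addrAC eq_sym subr_eq addrC AB.
Qed.

(** For a metric connection, half of a bimodule connection suffices: if the
[P]-part of the defect of right linearity is given by a bimodule map [S], then
the complementary part, which the involution exchanges with it, is given by the
transpose of [S]. *)
Lemma metric_bimodule_connection
    (P P' : bimodHom (Omega1 Cal) (Omega1 Cal))
    (S : bimodHom (tens E (Omega1 Cal)) (tens (Omega1 Cal) E))
    (nabla : E -> tens (Omega1 Cal) E) :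
  (forall w, w = P w + P' w) ->
  (forall w, P' (star_form w) = star_form (P w)) ->
  left_connection nabla -> metric_compatible H nabla ->
  (forall e b, tmap P (bimod_id E) (nabla (e :* b) - nabla e :* b) =
               S (tpure e (d0 Cal b))) ->
  bimodule_connection nabla.
Proof.
move=> PP' Pstar conn comp SP; split=> //.
exists (bimod_add S (metric_transpose S)) => e b.
rewrite addrC; apply: (canRL (subrK _)); apply: contr_l_inj => g.
rewrite bimod_addE [RHS]contr_lD contr_l_metric_transpose -SP contr_l_tmap.
by rewrite -d0_star -SP (contr_r_tmap _ _ Pstar) -metric_defect // -PP'.
Qed.
End MetricBimoduleConnection.

(** * The Chern connection of the (1,0)-forms *)

Section ChernBimodule.
Variables (C : numClosedFieldType) (B : starAlgType C).
Variables (Cal : star_calculus B) (X : complex_structure Cal).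

Lemma Omega1_split (w : Omega1 Cal) :
  w = incl_hom X 0 1 (pi_hom X 1 0 1 w) + incl_hom X 1 0 (pi_hom X 1 1 0 w).
Proof.
apply: form_eq; have [y [yP wE]] := (Om_deg X 1 (form_val w)).1 (form_in w).
have [X0 X1] := (yP ord0, yP ord_max).
rewrite form_valD /= wE big_ord_recl big_ord1 !linearD /=.
rewrite (_ : lift ord0 ord0 = ord_max); last exact: val_inj.
rewrite (pr_id (Om_sum X) (i := (0, 1)%N) X0).
rewrite (pr_ne (Om_sum X) (i := (1, 0)%N) (j := (0, 1)%N) X1) //.
rewrite (pr_ne (Om_sum X) (i := (0, 1)%N) (j := (1, 0)%N) X0) //.
by rewrite (pr_id (Om_sum X) (i := (1, 0)%N) X1) addr0 add0r.
Qed.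

Lemma pi_incl p q (x : forms (Om X p q)) :
  pi_hom X (p + q) p q (incl_hom X p q x) = x.
Proof.
apply: form_eq; apply: (pr_id (Om_sum X) (i := (p, q))); exact: form_in.
Qed.

Lemma star_pi01 (w : Omega1 Cal) :
  incl_hom X 1 0 (pi_hom X 1 1 0 (star_form w)) =
  star_form (incl_hom X 0 1 (pi_hom X 1 0 1 w)).
Proof.
rewrite {1}(Omega1_split w) star_formD !linearD.
set u := pi_hom X 1 0 1 w; set v := pi_hom X 1 1 0 w.
rewrite -[RHS]addr0; congr (_ + _); apply: form_eq.
  by apply: (pr_id (Om_sum X) (i := (1, 0)%N)); apply: (Om_star (form_in u)).
apply: (pr_ne (Om_sum X) (i := (0, 1)%N) (j := (1, 0)%N)) => //.
exact: (Om_star (form_in v)).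
Qed.

Definition wedge_l_hom p q :
  bimodHom (tens (forms (Om X 0 q)) (forms (Om X p 0))) (forms (Om X p q)).
Proof.
by apply: (tlift_hom (@mul_l_balanced _ _ _ X p q)) => *; apply: form_eq;
  [apply: esym (mulrA _ _ _) | apply: mulrA].
Defined.

Definition wedge_r_hom p q :
  bimodHom (tens (forms (Om X p 0)) (forms (Om X 0 q))) (forms (Om X p q)).
Proof.
by apply: (tlift_hom (@mul_r_balanced _ _ _ X p q)) => *; apply: form_eq;
  [apply: esym (mulrA _ _ _) | apply: mulrA].
Defined.

(** The Leibniz rule for [d] produces [- e d(b)]; only the (0,1)-part of [db]
contributes in bidegree (1,1), since [e] has type (1,0). *)
Lemma delbar_ract (e : forms (Om X 1 0)) b :
  delbar (e :* b) = delbar e :* b - mul_r e (pi_hom X 1 0 1 (d0 Cal b)).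
Proof.
apply: form_eq => /=; rewrite (dextM _ (Om_Omk (form_in e))) expr1 linearD.
rewrite -[LHS]/(prpq X 1 1 _ + _) prpqZr mulN1r linearN; congr (_ - _).
set w := d0 Cal b; rewrite -[dext _ _]/(form_val w) {1}(Omega1_split w).
rewrite form_valD mulrDr linearD.
rewrite (pr_id (Om_sum X) (i := (1, 1)%N)); last first.
  exact: (OmM (form_in e) (form_in (pi_hom X 1 0 1 w))).
rewrite (pr_ne (Om_sum X) (i := (2, 0)%N) (j := (1, 1)%N)) ?addr0 //.
exact: (OmM (form_in e) (form_in (pi_hom X 1 1 0 w))).
Qed.

Hypothesis Xfact : factorizable X.

Definition theta_l_hom p q :
    bimodHom (forms (Om X p q)) (tens (forms (Om X 0 q)) (forms (Om X p 0))) :=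
  let wK := wedge_lK Xfact p q in
  @bimod_inv _ _ _ _ (wedge_l_hom p q) (@theta_l _ _ _ X p q) wK.1 wK.2.

(** The bimodule map [e (x) w |-> - theta_l(e /\ w^(0,1))], to be evaluated at
[w = db]. *)
Definition dbar_symbol :
    bimodHom (tens (forms (Om X 1 0)) (Omega1 Cal))
             (tens (forms (Om X 0 1)) (forms (Om X 1 0))) :=
  bimod_opp (bimod_comp (theta_l_hom 1 1) (bimod_comp (wedge_r_hom 1 1)
    (tmap_hom (bimod_id _) (pi_hom X 1 0 1)))).

Lemma dbar_10_ract (e : forms (Om X 1 0)) b :
  dbar_10 (e :* b) = dbar_10 e :* b + dbar_symbol (tpure e (d0 Cal b)).
Proof.
have dbarE w : dbar_10 w = theta_l_hom 1 1 (delbar w) by [].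
rewrite !dbarE delbar_ract linearB bimod_funP; congr (_ - theta_l_hom 1 1 _).
rewrite -[RHS]/(wedge_r_hom 1 1 (tmap _ _ (tpure e (d0 Cal b)))).
by rewrite tmap_pure tlift_homE.
Qed.

Lemma chern_bimodule_connection (H : hermitian_metric (forms (Om X 1 0)))
    (nabla : forms (Om X 1 0) -> tens (Omega1 Cal) (forms (Om X 1 0))) :
  finitely_generated (Omega1 Cal) -> projective (Omega1 Cal) ->
  is_chern (X := X) H (@dbar_10 _ _ _ X) nabla -> bimodule_connection nabla.
Proof.
move=> fg proj [conn comp nabla01].
have [n [x [f xf]]] := metric_frame_exists H (@pi_incl 1 0) fg proj.
pose incl01 := tmap_hom (incl_hom X 0 1) (bimod_id (forms (Om X 1 0))).
pose pi01 := tmap_hom (pi_hom X 1 0 1) (bimod_id (forms (Om X 1 0))).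
apply: (metric_bimodule_connection xf
  (P := bimod_comp (incl_hom X 0 1) (pi_hom X 1 0 1))
  (P' := bimod_comp (incl_hom X 1 0) (pi_hom X 1 1 0))
  (S := bimod_comp incl01 dbar_symbol)) => // [||e b].
- exact: Omega1_split.
- exact: star_pi01.
- rewrite tmap_compl -[LHS]/(incl01 (pi01 _)); congr (incl01 _).
  rewrite linearB bimod_funP.
  rewrite [pi01 (nabla (e :* b))]nabla01 [pi01 (nabla e)]nabla01.
  by rewrite dbar_10_ract addrAC subrr add0r.
Qed.

End ChernBimodule.

(** * The opposite structure and direct sums of connections *)

Section SumOfConnections.
Variables (C : numClosedFieldType) (B : starAlgType C).
Variables (Cal : star_calculus B) (X : complex_structure Cal).

Lemma op_wedge_r p q (t : tens (forms (Om X 0 p)) (forms (Om X q 0))) :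
  wedge_r (X := op_cs X) (p := p) (q := q) t = wedge_l t.
Proof. by apply: eq_bigr => i _; apply: form_eq. Qed.

Lemma op_factorizable : factorizable X -> factorizable (op_cs X).
Proof.
move=> Xfact p q; have [wl wr] := Xfact q p.
by split; [apply: (eq_bij wr) => t; rewrite op_wedge_l
          |apply: (eq_bij wl) => t; rewrite op_wedge_r].
Qed.

Lemma is_chern_ext (E : bimodType B) (H : hermitian_metric E)
    (dbarE dbarE' : E -> tens (forms (Om X 0 1)) E)
    (nabla : E -> tens (Omega1 Cal) E) :
  dbarE =1 dbarE' -> is_chern H dbarE nabla -> is_chern H dbarE' nabla.
Proof. by move=> dE [conn comp n01]; split=> // e; rewrite n01 dE. Qed.

Section Transport.
Variables (M E : bimodType B) (p : bimodHom M E) (s : bimodHom E M).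
Variable nabla : E -> tens (Omega1 Cal) E.

(** The contribution of a direct summand E of M to a connection on M; the two
summands [Omega^(1,0)] and [Omega^(0,1)] of [Omega^1] are both of this kind. *)
Definition conn_transport (m : M) : tens (Omega1 Cal) M :=
  tmap_hom (bimod_id (Omega1 Cal)) s (nabla (p m)).

Lemma conn_transport_Clinear : Clinear nabla -> Clinear conn_transport.
Proof.
by move=> nC a x y; rewrite /conn_transport linearD linearZ nC linearD linearZ.
Qed.

(** The inhomogeneous term involves only the component [s (p m)] of [m]; summing
over complementary summands restores the Leibniz rule. *)
Lemma conn_transport_leibniz b m : left_connection nabla ->
  conn_transport (b *: m) = b *: conn_transport m + tpure (d0 Cal b) (s (p m)).
Proof.
move=> [_ nL]; rewrite /conn_transport !linearZ nL linearD linearZ.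
by rewrite [X in _ + X]tmap_pure.
Qed.

Lemma conn_transport_symbol : bimodule_connection nabla ->
  exists sigma : bimodHom (tens M (Omega1 Cal)) (tens (Omega1 Cal) M),
    forall m b, conn_transport (m :* b) =
                conn_transport m :* b + sigma (tpure m (d0 Cal b)).
Proof.
move=> [_ [sigma sP]].
exists (bimod_comp (tmap_hom (bimod_id _) s)
         (bimod_comp sigma (tmap_hom p (bimod_id _)))) => m b.
rewrite /conn_transport bimod_funP sP linearD bimod_funP; congr (_ + _).
rewrite -[RHS]/(tmap_hom (bimod_id _) s
                  (sigma (tmap _ _ (tpure m (d0 Cal b))))).
by rewrite tmap_pure.
Qed.

End Transport.

Lemma sum_bimodule_connection
    (nabla1 : forms (Om X 1 0) -> tens (Omega1 Cal) (forms (Om X 1 0)))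
    (nabla2 : forms (Om X 0 1) -> tens (Omega1 Cal) (forms (Om X 0 1))) :
  bimodule_connection nabla1 -> bimodule_connection nabla2 ->
  bimodule_connection (sum_connection nabla1 nabla2).
Proof.
move=> bc1 bc2; have [c1 _] := bc1; have [c2 _] := bc2.
pose t1 : Omega1 Cal -> tens (Omega1 Cal) (Omega1 Cal) :=
  conn_transport (pi_hom X 1 1 0) (incl_hom X 1 0) nabla1.
pose t2 : Omega1 Cal -> tens (Omega1 Cal) (Omega1 Cal) :=
  conn_transport (pi_hom X 1 0 1) (incl_hom X 0 1) nabla2.
have sumE w : sum_connection nabla1 nabla2 w = t1 w + t2 w by [].
split.
  split=> [a x y|b w]; rewrite !sumE.
    rewrite [t1 _]conn_transport_Clinear; last exact: conn_lin c1.
    rewrite [t2 _]conn_transport_Clinear; last exact: conn_lin c2.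
    by rewrite addrACA -scalerDr.
  rewrite [t1 _](conn_transport_leibniz _ _ _ _ c1).
  rewrite [t2 _](conn_transport_leibniz _ _ _ _ c2).
  by rewrite addrACA -scalerDr -tpureDr [X in tpure _ X]addrC -Omega1_split.
have [s1 s1P] := conn_transport_symbol (pi_hom X 1 1 0) (incl_hom X 1 0) bc1.
have [s2 s2P] := conn_transport_symbol (pi_hom X 1 0 1) (incl_hom X 0 1) bc2.
exists (bimod_add s1 s2) => w b; rewrite !sumE bimod_addE ractDl.
by rewrite [t1 _]s1P [t2 _]s2P addrACA.
Qed.

End SumOfConnections.

Theorem theorem5p8 (R : realType) (B : starAlgType R[i])
    (Cal : star_calculus B) (X : complex_structure Cal)
    (Xfact : factorizable X)
    (Omega1_fg : finitely_generated (Omega1 Cal))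
    (Omega1_proj : projective (Omega1 Cal))
    (H1 : hermitian_metric (forms (Om X 1 0)))
    (H2 : hermitian_metric (forms (Om X 0 1)))
    (nablaCh : forms (Om X 1 0) -> tens (Omega1 Cal) (forms (Om X 1 0)))
    (nablaChop : forms (Om X 0 1) -> tens (Omega1 Cal) (forms (Om X 0 1)))
    (Ch : is_chern (X := X) H1 (@dbar_10 _ _ _ X) nablaCh)
    (Chop : is_chern (X := op_cs X) H2 (@del_01 _ _ _ X) nablaChop) :
  bimodule_connection (sum_connection nablaCh nablaChop).
Proof.
apply: sum_bimodule_connection.
  exact: chern_bimodule_connection Xfact _ _ Omega1_fg Omega1_proj Ch.
(* [Om (op_cs X) 1 0] is convertible to [Om X 0 1]. *)
apply: (chern_bimodule_connection (X := op_cs X) (op_factorizable Xfact)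
          (H := H2)) => //.
apply: is_chern_ext Chop => w; exact: esym (op_dbar_10 w).
Qed.
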